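(* In the edge-distinguishing game (EDGe) played on the path $P_4$ (with $\lambda(P_4)$ colors), Player 1 has a winning strategy.
   Context: $P_n$ is the path on $n$ vertices. For a positive integer $k$ let $[k]=\{1,\dots,k\}$. A $k$-coloring $c:V(G)\to[k]$ induces $c'(\{u,v\})=\{c(u),c(v)\}$ (a multiset); $c$ is edge-distinguishing if $c'$ is injective, and $\lambda(G)$ is the least $k$ admitting such a coloring. A partial coloring on $U\subseteq V(G)$ has partial induced edge coloring on $G[U]$. EDGe on $G$: two players, Player 1 first, alternately color an uncolored vertex with a color from $[\lambda(G)]$; a move is legal iff afterwards the partial induced edge coloring of the colored vertices is injective. The player making the last legal move wins. A winning strategy guarantees a win regardless of the opponent's play. *)

(* Defs.v *)
From mathcomp Require Import all_boot.
From mathcomp Require Import finmap multiset.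

Set Implicit Arguments.
Unset Strict Implicit.
Unset Printing Implicit Defensive.

Local Open Scope mset_scope.
Local Open Scope nat_scope.

Record sgraph := SGraph {
  vertex :> finType;
  adj : rel vertex;
  adj_sym : symmetric adj;
  adj_irrefl : irreflexive adj
}.

Definition path_adj (n : nat) : rel 'I_n :=
  fun i j => (i.+1 == j :> nat) || (j.+1 == i :> nat).

Lemma path_adj_sym n : symmetric (@path_adj n).
Proof. by move=> i j; rewrite /path_adj orbC. Qed.

Lemma path_adj_irrefl n : irreflexive (@path_adj n).
Proof. by move=> i; rewrite /path_adj orbb; apply/negbTE; rewrite gtn_eqF. Qed.

Definition path_graph (n : nat) : sgraph :=
  SGraph (@path_adj_sym n) (@path_adj_irrefl n).

Definition edges (G : sgraph) : {set {set G}} :=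
  [set [set p.1; p.2] | p : G * G & adj p.1 p.2].

(* The color set [k] is represented by 'I_k. *)

Definition induced_edge_coloring (G : sgraph) (k : nat)
    (c : {ffun G -> 'I_k}) (E : {set G}) : {mset 'I_k} :=
  seq_mset [seq c v | v <- enum E].

Definition edge_distinguishing (G : sgraph) (k : nat)
    (c : {ffun G -> 'I_k}) : bool :=
  dinjectiveb (induced_edge_coloring c) (edges G).

Definition has_edge_distinguishing (G : sgraph) (k : nat) : bool :=
  (0 < k) && [exists c : {ffun G -> 'I_k}, edge_distinguishing c].

(* Giving all vertices different colors is always edge-distinguishing. *)
Lemma ex_edge_distinguishing (G : sgraph) : exists k, has_edge_distinguishing G k.
Proof.
exists #|G|.+1; rewrite /has_edge_distinguishing /=; apply/existsP.
pose f (v : G) : 'I_#|G|.+1 := widen_ord (leqnSn _) (enum_rank v).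
have f_inj : injective f.
  by move=> u v /(congr1 val) /= /val_inj /enum_rank_inj.
exists (finfun f); apply/dinjectiveP => A B _ _ /eq_seq_msetP AB.
have memE (E : {set G}) v :
    (f v \in [seq finfun f u | u <- enum E]) = (v \in E).
  by rewrite (eq_map (ffunE f)) mem_map // mem_enum.
by apply/setP => v; rewrite -!memE (perm_mem AB).
Qed.

Definition lambda (G : sgraph) : nat := ex_minn (ex_edge_distinguishing G).

(* A partial coloring is defined on U = colored c; None marks an uncolored
   vertex. *)
Definition partial_coloring (G : sgraph) (k : nat) := {ffun G -> option 'I_k}.

Definition colored (G : sgraph) (k : nat) (c : partial_coloring G k) : {set G} :=
  [set v | c v != None].

Definition induced_edges (G : sgraph) (U : {set G}) : {set {set G}} :=
  [set E in edges G | E \subset U].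

Definition partial_induced_edge_coloring (G : sgraph) (k : nat)
    (c : partial_coloring G k) (E : {set G}) : {mset 'I_k} :=
  seq_mset (pmap c (enum E)).

Definition partial_edge_distinguishing (G : sgraph) (k : nat)
    (c : partial_coloring G k) : bool :=
  dinjectiveb (partial_induced_edge_coloring c) (induced_edges (colored c)).

Definition move (G : sgraph) (k : nat) : Type := (G * 'I_k)%type.

Definition uncolored (G : sgraph) (k : nat) : partial_coloring G k :=
  [ffun => None].

Definition make_move (G : sgraph) (k : nat) (c : partial_coloring G k)
    (m : move G k) : partial_coloring G k :=
  [ffun v => if v == m.1 then Some m.2 else c v].

Definition legal (G : sgraph) (k : nat) (c : partial_coloring G k)
    (m : move G k) : bool :=
  (c m.1 == None) && partial_edge_distinguishing (make_move c m).

(* A history is the sequence of moves made so far, earliest first. *)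
Definition position (G : sgraph) (k : nat) (h : seq (move G k)) :
    partial_coloring G k :=
  foldl (@make_move G k) (uncolored G k) h.

Definition legal_history (G : sgraph) (k : nat) (h : seq (move G k)) : Prop :=
  forall h1 m h2, h = h1 ++ m :: h2 -> legal (position h1) m.

Definition game_over (G : sgraph) (k : nat) (h : seq (move G k)) : Prop :=
  forall m, ~~ legal (position h) m.

Inductive player := Player1 | Player2.

(* The player making the move preceded by i earlier moves. *)
Definition mover (i : nat) : player := if odd i then Player2 else Player1.

Definition made_last_move (G : sgraph) (k : nat) (p : player)
    (h : seq (move G k)) : Prop :=
  exists h' m, h = rcons h' m /\ mover (size h') = p.

Definition strategy (G : sgraph) (k : nat) := seq (move G k) -> move G k.

Definition follows (G : sgraph) (k : nat) (p : player) (s : strategy G k)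
    (h : seq (move G k)) : Prop :=
  forall h1 m h2, h = h1 ++ m :: h2 -> mover (size h1) = p -> m = s h1.

(* The first clause is needed because strategies are total functions: when it is
   p's turn and a legal move exists, the strategy must actually give one. *)
Definition winning_strategy (G : sgraph) (k : nat) (p : player)
    (s : strategy G k) : Prop :=
  forall h, legal_history h -> follows p s h ->
    (mover (size h) = p -> ~ game_over h -> legal (position h) (s h)) /\
    (game_over h -> made_last_move p h).

Definition EDGe_has_winning_strategy (G : sgraph) (p : player) : Prop :=
  exists s : strategy G (lambda G), winning_strategy p s.

(* Main.v *)
Require Import Defs.
From mathcomp Require Import all_boot.
From mathcomp Require Import multiset.

Set Implicit Arguments.
Unset Strict Implicit.
Unset Printing Implicit Defensive.

(** Write [v0 v1 v2 v3] for the path.  Neighbours of a common vertex have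
    different colors in an edge-distinguishing coloring, so [lambda P_4 = 2] and
    the only such 2-colorings are [aabb].  In particular [v1] and [v3] get
    different colors, and [v2] and [v3] the same one.  Player 1 colors [v0]; to
    any answer there is a reply that violates one of these two conditions and
    leaves [v1] or [v2] uncolored.  At most one edge is then colored, so the
    reply is legal, and the last vertex can never be colored: the game ends
    after exactly three moves. *)

Lemma perm_eq_pair (T : eqType) (a b x y : T) :
  perm_eq [:: a; b] [:: x; y] =
  ((a == x) && (b == y)) || ((a == y) && (b == x)).
Proof.
have perm_cons1 z u v : perm_eq [:: z; u] [:: z; v] = (u == v :> T).
  by rewrite perm_cons; apply/idP/eqP => [/perm_mem/(_ u)|->//];
     rewrite !inE eqxx => /esym/eqP.
have perm_swap z u : perm_eql [:: z; u : T] [:: u; z].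
  by apply/permPl; rewrite (perm_catC [:: z] [:: u]).
apply/idP/orP => [ab_xy|[] /andP[/eqP-> /eqP->] //]; last by rewrite perm_swap.
have: a \in [:: x; y] by rewrite -(perm_mem ab_xy) mem_head.
rewrite !inE => /orP[] /eqP a_eq; move: ab_xy; rewrite a_eq.
  by rewrite perm_cons1 eqxx; left.
by rewrite perm_sym perm_swap perm_cons1 eqxx eq_sym; right.
Qed.

Lemma ord2_eq_of_neq (a b d : 'I_2) : a != d -> b != d -> a = b.
Proof.
case: a b d => [[|[|//]] ?] [[|[|//]] ?] [[|[|//]] ?] // _ _; exact: val_inj.
Qed.

Lemma perm_enum_set2 (T : finType) (u v : T) :
  u != v -> perm_eq (enum [set u; v]) [:: u; v].
Proof.
move=> uv; apply: uniq_perm; rewrite ?enum_uniq //= ?inE ?uv //.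
by move=> x; rewrite mem_enum !inE.
Qed.

Section EdgeColoring.

Variable G : sgraph.
Implicit Types (u v w x y : G) (E : {set G}).

Lemma edgesP E :
  reflect (exists u v, adj u v /\ E = [set u; v]) (E \in edges G).
Proof.
apply: (iffP imsetP) => [[[u v] /= + ->]|[u [v [uv ->]]]].
  by rewrite inE => uv; exists u, v.
by exists (u, v); rewrite ?inE.
Qed.

Lemma adj_neq u v : adj u v -> u != v.
Proof. by apply: contraTneq => ->; rewrite adj_irrefl. Qed.

Lemma induced_edge_coloring_adj k (c : {ffun G -> 'I_k}) u v :
  adj u v -> induced_edge_coloring c [set u; v] = seq_mset [:: c u; c v].
Proof.
by move=> /adj_neq uv; apply/eq_seq_msetP/(perm_map c (perm_enum_set2 uv)).
Qed.

(* Both edges can be oriented so that equality of the color multisets becomes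
   equality of the colors at corresponding ends. *)
Lemma edge_distinguishingP k (c : {ffun G -> 'I_k}) :
  reflect (forall u v x y, adj u v -> adj x y -> c u = c x -> c v = c y ->
             [set u; v] = [set x; y])
          (edge_distinguishing c).
Proof.
apply: (iffP (@dinjectiveP _ _ _ _)) => [inj u v x y uv xy cux cvy | end_inj].
  apply: inj; try by apply/edgesP; do 2![eexists]; split; last reflexivity.
  by rewrite !induced_edge_coloring_adj // cux cvy.
move=> _ _ /edgesP[u [v [uv ->]]] /edgesP[x [y [xy ->]]].
rewrite !induced_edge_coloring_adj // => /eq_seq_msetP.
rewrite perm_eq_pair => /orP[] /andP[/eqP cu /eqP cv]; first exact: end_inj.
by rewrite [RHS]setUC; apply: end_inj; rewrite // adj_sym.
Qed.

Lemma edge_distinguishing_neighbors k (c : {ffun G -> 'I_k}) v u w :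
  edge_distinguishing c -> adj v u -> adj v w -> u != w -> c u != c w.
Proof.
move=> /edge_distinguishingP end_inj vu vw uw; apply/eqP => cuw.
have /setP/(_ u) := end_inj v u v w vu vw erefl cuw.
by rewrite !inE eqxx orbT (negbTE uw) orbF eq_sym (negbTE (adj_neq vu)).
Qed.

Lemma edge_distinguishing_lambda :
  exists c : {ffun G -> 'I_(lambda G)}, edge_distinguishing c.
Proof. by rewrite /lambda; case: ex_minnP => k /andP[_ /existsP]. Qed.

Lemma lambda_le k (c : {ffun G -> 'I_k}) :
  0 < k -> edge_distinguishing c -> lambda G <= k.
Proof.
rewrite /lambda => k_gt0 dist_c; case: ex_minnP => n _; apply.
by rewrite /has_edge_distinguishing k_gt0; apply/existsP; exists c.
Qed.

Lemma lambda_gt1 v u w : adj v u -> adj v w -> u != w -> 1 < lambda G.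
Proof.
move=> vu vw uw; have [c dist_c] := edge_distinguishing_lambda.
have := edge_distinguishing_neighbors dist_c vu vw uw.
case: (lambda G) c {dist_c} => [|[|//]] c; first by case: (c v).
by rewrite !ord1 eqxx.
Qed.

Lemma partial_edge_distinguishing_total k (c : {ffun G -> 'I_k}) :
  partial_edge_distinguishing ([ffun v => Some (c v)] : partial_coloring G k)
  = edge_distinguishing c.
Proof.
set p : partial_coloring G k := [ffun v => _].
have pE E : partial_induced_edge_coloring p E = induced_edge_coloring c E.
  rewrite /partial_induced_edge_coloring /induced_edge_coloring; congr seq_mset.
  by elim: (enum E) => //= v s ->; rewrite ffunE.
have edgesE : induced_edges (colored p) =i edges G.
  move=> E; rewrite !inE; case: (E \in edges G) => //=.
  by apply/subsetP => v _; rewrite inE ffunE.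
by apply/dinjectiveP/dinjectiveP => inj E F EG FG EF;
  apply: inj; rewrite ?edgesE ?pE // -?edgesE // -!pE.
Qed.

Lemma partial_edge_distinguishing_le1 k (p : partial_coloring G k) :
  #|induced_edges (colored p)| <= 1 -> partial_edge_distinguishing p.
Proof.
by move=> /card_le1_eqP all_eq; apply/dinjectiveP => E F EG FG _; apply: all_eq.
Qed.

End EdgeColoring.

Section Game.

Variables (G : sgraph) (k : nat).
Implicit Types (h : seq (move G k)) (m : move G k).

Definition extends (c : {ffun G -> 'I_k}) (p : partial_coloring G k) : Prop :=
  forall v a, p v = Some a -> c v = a.

Lemma game_over_no_extension h (u : G) :
  (forall v, v != u -> position h v != None) ->
  (forall c, extends c (position h) -> ~~ edge_distinguishing c) ->
  game_over h.
Proof.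
move=> colored_but_u no_ext m; apply/negP => /andP[/eqP free dist_m].
have m_u : m.1 = u.
  by apply/eqP; apply: contra_eqT free => /colored_but_u.
pose c : {ffun G -> 'I_k} := [ffun v => odflt m.2 (position h v)].
have /no_ext/negP[] : extends c (position h) by move=> v a; rewrite ffunE => ->.
rewrite -partial_edge_distinguishing_total.
suff <- : make_move (position h) m = [ffun v => Some (c v)] by [].
apply/ffunP => v; rewrite !ffunE.
have [->|] := eqVneq v m.1; first by rewrite free.
by rewrite m_u => /colored_but_u; case: (position h v).
Qed.

Variables (opening : move G k) (reply : move G k -> move G k).

Definition three_move_strategy : strategy G k :=
  fun h => if h is [:: _; m] then reply m else opening.

Lemma three_move_winning_strategy :
  legal (position [::]) opening ->
  (exists m, legal (position [:: opening]) m) ->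
  (forall m, legal (position [:: opening]) m ->
     legal (position [:: opening; m]) (reply m) /\
     game_over [:: opening; m; reply m]) ->
  winning_strategy Player1 three_move_strategy.
Proof.
move=> opening_legal [answer answer_legal] reply_wins h h_legal h_follows.
case: h => [|m [|m1 [|m2 h]]] in h_legal h_follows *.
- by split=> [//|/(_ opening)]; rewrite opening_legal.
- have -> : m = opening by apply: (h_follows [::] m [::]).
  by split=> [//|/(_ answer)]; rewrite answer_legal.
- have m_opening : m = opening by apply: (h_follows [::] m [:: m1]).
  rewrite m_opening in h_legal *.
  have [reply_legal _] := reply_wins m1 (h_legal [:: opening] m1 [::] erefl).
  by split=> [//|/(_ (reply m1))]; rewrite reply_legal.
have m_opening : m = opening by apply: (h_follows [::] m [:: m1, m2 & h]).
have m2_reply : m2 = reply m1 by apply: (h_follows [:: m; m1] m2 h).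
rewrite m_opening m2_reply in h_legal *.
have [_ over] := reply_wins m1 (h_legal [:: opening] m1 (reply m1 :: h) erefl).
case: h => [|m3 h] in h_legal h_follows *.
  by split=> [//|_]; exists [:: opening; m1], (reply m1).
have := h_legal [:: opening; m1; reply m1] m3 h erefl.
by rewrite (negbTE (over m3)).
Qed.

End Game.

(* Closed proofs, unlike [inord], let adjacency and equality tests compute. *)
Local Notation "''v_' i" := (@Ordinal 4 i isT : path_graph 4)
  (at level 8, i at level 2).

Lemma path4_ind (P : path_graph 4 -> Prop) :
  P 'v_0 -> P 'v_1 -> P 'v_2 -> P 'v_3 -> forall v, P v.
Proof.
move=> P0 P1 P2 P3 [[|[|[|[|//]]]] lt_v];
  by rewrite (bool_irrelevance lt_v isT).
Qed.

Lemma path4_edgeE (u v : path_graph 4) :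
  adj u v ->
  [set u; v] = if (u < 2) && (v < 2) then [set 'v_0; 'v_1]
               else if (u < 2) || (v < 2) then [set 'v_1; 'v_2]
               else [set 'v_2; 'v_3].
Proof.
by elim/path4_ind: u; elim/path4_ind: v => // _; rewrite // setUC.
Qed.

Lemma path4_edge_distinguishing2E (c : {ffun path_graph 4 -> 'I_2}) :
  edge_distinguishing c =
  [&& c 'v_0 == c 'v_1, c 'v_1 != c 'v_2 & c 'v_2 == c 'v_3].
Proof.
apply/idP/and3P => [dist_c | [/eqP c01 c12 /eqP c23]].
  have c02 : c 'v_0 != c 'v_2.
    exact: (@edge_distinguishing_neighbors _ _ _ 'v_1).
  have c13 : c 'v_1 != c 'v_3.
    exact: (@edge_distinguishing_neighbors _ _ _ 'v_2).
  have c12 : c 'v_1 != c 'v_2.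
    apply/eqP => c12.
    have c03 : c 'v_0 = c 'v_3.
      by apply: ord2_eq_of_neq c02 _; rewrite -c12 eq_sym.
    move/edge_distinguishingP: dist_c.
    move=> /(_ 'v_0 'v_1 'v_3 'v_2 isT isT c03 c12)/setP/(_ 'v_0).
    by rewrite !inE.
  split=> //; apply/eqP; first exact: ord2_eq_of_neq c02 c12.
  by apply: (@ord2_eq_of_neq _ _ (c 'v_1)); rewrite eq_sym.
have cE v : c v = if v < 2 then c 'v_1 else c 'v_2.
  by elim/path4_ind: v.
have c_eq u x : c u = c x -> (u < 2) = (x < 2).
  rewrite (cE u) (cE x) => /eqP; case: ltnP => _; case: ltnP => _ //.
  - by rewrite (negbTE c12).
  - by rewrite eq_sym (negbTE c12).
apply/edge_distinguishingP => u v x y uv xy /c_eq ux /c_eq vy.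
by rewrite (path4_edgeE uv) (path4_edgeE xy) ux vy.
Qed.

Lemma lambda_path4 : lambda (path_graph 4) = 2.
Proof.
apply/eqP; rewrite eqn_leq (@lambda_gt1 _ 'v_1 'v_0 'v_2) // andbT.
pose aabb : {ffun path_graph 4 -> 'I_2} :=
  [ffun v => if val v < 2 then ord0 else ord_max].
apply: (@lambda_le _ _ aabb) => //.
by rewrite path4_edge_distinguishing2E !ffunE.
Qed.

Lemma path4_inner_uncolored_distinguishing k
    (p : partial_coloring (path_graph 4) k) :
  (p 'v_1 == None) || (p 'v_2 == None) -> partial_edge_distinguishing p.
Proof.
move=> inner.
pose e := if p 'v_1 == None then [set 'v_2; 'v_3] else [set 'v_0; 'v_1].
apply/partial_edge_distinguishing_le1/(leq_trans _ (eq_leq (cards1 e))).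
apply/subset_leq_card/subsetP => E; rewrite !inE.
case/andP=> /edgesP[u [v [uv ->]]]; rewrite subUset !sub1set !inE {}/e.
case: eqP inner => [pv1 _|_ /eqP pv2] /andP[];
  elim/path4_ind: u uv; elim/path4_ind: v => // _;
  by rewrite ?pv1 ?pv2 // setUC.
Qed.

Definition path4_reply (m : move (path_graph 4) 2) : move (path_graph 4) 2 :=
  if m.1 == 'v_1 then ('v_3, m.2)
  else if m.1 == 'v_2 then ('v_3, rev_ord m.2)
  else ('v_1, m.2).

Section Replies.

Variables (a : 'I_2) (m : move (path_graph 4) 2).
Hypothesis m_neq_v0 : m.1 != 'v_0.

Lemma path4_reply_legal : legal (position [:: ('v_0, a); m]) (path4_reply m).
Proof.
rewrite /legal /path4_reply; case: m m_neq_v0 => v b /=.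
elim/path4_ind: v => //= _;
  by rewrite path4_inner_uncolored_distinguishing !ffunE.
Qed.

Lemma path4_reply_game_over : game_over [:: ('v_0, a); m; path4_reply m].
Proof.
pose free : path_graph 4 := if m.1 == 'v_2 then 'v_1 else 'v_2.
apply: (game_over_no_extension (u := free)) => [|c c_ext].
  rewrite /free /path4_reply; case: m m_neq_v0 => v b /=.
  by elim/path4_ind: v => // _; elim/path4_ind=> // _; rewrite !ffunE.
rewrite path4_edge_distinguishing2E; apply/and3P=> -[_ c12 /eqP c23].
have [m_v2|m_neq_v2] := eqVneq m.1 'v_2.
  have c2 : c 'v_2 = m.2.
    by apply: c_ext; rewrite /path4_reply m_v2 !ffunE /= m_v2.
  have c3 : c 'v_3 = rev_ord m.2.
    by apply: c_ext; rewrite /path4_reply m_v2 !ffunE.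
  by move: c23; rewrite c2 c3; case: m.2 => [[|[|//]] ?] /(congr1 val).
have [c1 c3] : c 'v_1 = m.2 /\ c 'v_3 = m.2.
  split; apply: c_ext; case: m m_neq_v0 m_neq_v2 => v b /=;
    by elim/path4_ind: v => // _ _; rewrite !ffunE.
by move: c12; rewrite c23 c1 c3 eqxx.
Qed.

End Replies.

Theorem theorem3p9 : EDGe_has_winning_strategy (path_graph 4) Player1.
Proof.
rewrite /EDGe_has_winning_strategy lambda_path4.
exists (three_move_strategy ('v_0, ord0) path4_reply).
apply: three_move_winning_strategy => [| |m /andP[m_free _]].
- by rewrite /legal path4_inner_uncolored_distinguishing !ffunE.
- exists ('v_3, ord0).
  by rewrite /legal path4_inner_uncolored_distinguishing !ffunE.
have m_neq_v0 : m.1 != 'v_0.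
  by apply: contraTneq m_free => ->; rewrite !ffunE.
by split; [apply: path4_reply_legal | apply: path4_reply_game_over].
Qed.
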